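(* Let $k$ be a field, and let $X$ be the one dimensional projective nonreduced $k$-scheme consisting of a double line in $\mathbb P^2_k$. Let $T$ be a subset of the positive integers. There exists a graded linear series $L=\bigoplus_{n\ge 0}L_n$ for $\mathcal O_X(2)$ such that for all positive integers $n$, $$\dim_kL_n= \left\{\begin{array}{ll}n+1&\mbox{ if }n\in T\\ 0&\mbox{ if }n\not\in T,\end{array}\right.$$ and such that $q(L)=-\infty$ (while $\dim_kL_n$ is $O(n)=O(n^{\dim X})$).
   Context: The double line is $X=\mathrm{Proj}(k[x_0,x_1,x_2]/(x_1^2))$ for suitable homogeneous coordinates on $\mathbb P^2_k$. For a line bundle $\mathcal L$ on a projective scheme $X$ over a field $k$, a graded linear series for $\mathcal L$ is a graded $k$-subalgebra $L=\bigoplus_{n\ge 0}L_n$ of the section ring $\bigoplus_{n\ge 0}\Gamma(X,\mathcal L^n)$, where $\mathcal L^n=\mathcal L^{\otimes n}$ and $L_n\subset\Gamma(X,\mathcal L^n)$. Let $\sigma(L)$ be the maximum $m$ such that there exist $y_1,\ldots,y_m\in L$ which are homogeneous of positive degree and algebraically independent over $k$ ($\sigma(L)=0$ if there are no such elements with $m\ge 1$). The Kodaira-Iitaka dimension is $q(L)=\sigma(L)-1$ if $\sigma(L)>0$, and $q(L)=-\infty$ if $\sigma(L)=0$. *)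

(* Defs.v *)
From HB Require Import structures.
From mathcomp Require Import all_boot all_order all_algebra ring_quotient.
From mathcomp Require Import boolp ring.
From mathcomp Require Import mpoly.

Set Implicit Arguments.
Unset Strict Implicit.
Unset Printing Implicit Defensive.

Import GRing.Theory.
Local Open Scope ring_scope.
Local Open Scope quotient_scope.

(** * Localization of a commutative ring at a multiplicative subset *)

Record mulset (S : comNzRingType) := MulSet {
  mset :> S -> Prop;
  mset1 : mset 1;
  msetM : forall f g, mset f -> mset g -> mset (f * g) }.

Section Localization.
Variables (S : comNzRingType) (M : mulset S).

Definition prefrac := {x : S * S | `[< M x.2 >]}.

Implicit Types x y z : prefrac.

Lemma prefracP x : M (val x).2. Proof. exact/asboolP/(valP x). Qed.

Definition mkprefrac (a f : S) (Mf : M f) : prefrac :=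
  exist _ (a, f) (introT (asboolP (M f)) Mf).

Definition fraceq x y : bool :=
  `[< exists2 h, M h &
      h * ((val x).1 * (val y).2) = h * ((val y).1 * (val x).2) >].

Lemma fraceq_refl : reflexive fraceq.
Proof. by move=> x; apply/asboolP; exists 1 => //; apply: mset1. Qed.

Lemma fraceq_symP x y : fraceq x y -> fraceq y x.
Proof. by move=> /asboolP[h Mh e]; apply/asboolP; exists h. Qed.

Lemma fraceq_sym : ssrbool.symmetric fraceq.
Proof. by move=> x y; apply/idP/idP; apply: fraceq_symP. Qed.

Lemma fraceq_trans : transitive fraceq.
Proof.
move=> y x z /asboolP[h Mh e] /asboolP[g Mg e']; apply/asboolP.
exists (h * g * (val y).2).
  by apply: msetM; [apply: msetM | apply: prefracP].
by ring: e e'.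
Qed.

Canonical fraceq_equiv := EquivRel fraceq fraceq_refl fraceq_sym fraceq_trans.

Definition loc := {eq_quot fraceq}.
HB.instance Definition _ : EqQuotient _ fraceq loc := EqQuotient.on loc.
HB.instance Definition _ := Choice.on loc.

Definition frac (a f : S) (Mf : M f) : loc := \pi_loc (mkprefrac a Mf).

Lemma locW (P : loc -> Prop) :
  (forall a f (Mf : M f), P (frac a Mf)) -> forall u, P u.
Proof.
move=> H; elim/quotW => -[[a f] Mf].
have := H a f (elimT (asboolP _) Mf); rewrite /frac /mkprefrac.
by congr (P (\pi_loc _)); apply: val_inj.
Qed.

Lemma frac_eqP (a f b g : S) (Mf : M f) (Mg : M g) :
  frac a Mf = frac b Mg <-> exists2 h, M h & h * (a * g) = h * (b * f).
Proof.
split; first by move=> /eqmodP /asboolP.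
by move=> H; apply/eqmodP/asboolP.
Qed.

Definition prefrac_add x y : prefrac :=
  mkprefrac ((val x).1 * (val y).2 + (val y).1 * (val x).2)
            (msetM (prefracP x) (prefracP y)).
Definition prefrac_mul x y : prefrac :=
  mkprefrac ((val x).1 * (val y).1) (msetM (prefracP x) (prefracP y)).
Definition prefrac_opp x : prefrac := mkprefrac (- (val x).1) (prefracP x).

Definition loc_add (u v : loc) : loc := \pi_loc (prefrac_add (repr u) (repr v)).
Definition loc_mul (u v : loc) : loc := \pi_loc (prefrac_mul (repr u) (repr v)).
Definition loc_opp (u : loc) : loc := \pi_loc (prefrac_opp (repr u)).
Definition loc_inj (a : S) : loc := frac a (mset1 M).

Lemma repr_frac (a f : S) (Mf : M f) :
  exists2 h, M h & h * ((val (repr (frac a Mf))).1 * f) =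
                   h * (a * (val (repr (frac a Mf))).2).
Proof.
by have /eqmodP/asboolP[h Mh e] := reprK (frac a Mf); exists h.
Qed.

Lemma frac_add (a f b g : S) (Mf : M f) (Mg : M g) :
  loc_add (frac a Mf) (frac b Mg) = frac (a * g + b * f) (msetM Mf Mg).
Proof.
have [h Mh e] := repr_frac a Mf; have [h' Mh' e'] := repr_frac b Mg.
apply/eqmodP/asboolP; exists (h * h'); first exact: msetM.
by rewrite /=; ring: e e'.
Qed.

Lemma frac_mul (a f b g : S) (Mf : M f) (Mg : M g) :
  loc_mul (frac a Mf) (frac b Mg) = frac (a * b) (msetM Mf Mg).
Proof.
have [h Mh e] := repr_frac a Mf; have [h' Mh' e'] := repr_frac b Mg.
apply/eqmodP/asboolP; exists (h * h'); first exact: msetM.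
by rewrite /=; ring: e e'.
Qed.

Lemma frac_opp (a f : S) (Mf : M f) : loc_opp (frac a Mf) = frac (- a) Mf.
Proof.
have [h Mh e] := repr_frac a Mf.
by apply/eqmodP/asboolP; exists h => //=; ring: e.
Qed.

Lemma loc_addA : associative loc_add.
Proof.
elim/locW=> a f Mf; elim/locW=> b g Mg; elim/locW=> c h Mh.
by rewrite !frac_add; apply/frac_eqP; exists 1; [apply: mset1 | ring].
Qed.

Lemma loc_addC : commutative loc_add.
Proof.
elim/locW=> a f Mf; elim/locW=> b g Mg.
by rewrite !frac_add; apply/frac_eqP; exists 1; [apply: mset1 | ring].
Qed.

Lemma loc_add0 : left_id (loc_inj 0) loc_add.
Proof.
elim/locW=> a f Mf.
by rewrite frac_add; apply/frac_eqP; exists 1; [apply: mset1 | ring].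
Qed.

Lemma loc_addN : left_inverse (loc_inj 0) loc_opp loc_add.
Proof.
elim/locW=> a f Mf; rewrite frac_opp frac_add.
by apply/frac_eqP; exists 1; [apply: mset1 | ring].
Qed.

HB.instance Definition _ :=
  GRing.isZmodule.Build loc loc_addA loc_addC loc_add0 loc_addN.

Lemma loc_mulA : associative loc_mul.
Proof.
elim/locW=> a f Mf; elim/locW=> b g Mg; elim/locW=> c h Mh.
by rewrite !frac_mul; apply/frac_eqP; exists 1; [apply: mset1 | ring].
Qed.

Lemma loc_mulC : commutative loc_mul.
Proof.
elim/locW=> a f Mf; elim/locW=> b g Mg.
by rewrite !frac_mul; apply/frac_eqP; exists 1; [apply: mset1 | ring].
Qed.

Lemma loc_mul1 : left_id (loc_inj 1) loc_mul.
Proof.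
elim/locW=> a f Mf.
by rewrite frac_mul; apply/frac_eqP; exists 1; [apply: mset1 | ring].
Qed.

Lemma loc_mulD : left_distributive loc_mul +%R.
Proof.
elim/locW=> a f Mf; elim/locW=> b g Mg; elim/locW=> c h Mh.
rewrite [_ + _]frac_add !frac_mul [RHS]frac_add.
by apply/frac_eqP; exists 1; [apply: mset1 | ring].
Qed.

HB.instance Definition _ :=
  GRing.Zmodule_isComPzRing.Build loc loc_mulA loc_mulC loc_mul1 loc_mulD.

Lemma loc_inj_is_zmod_morphism : zmod_morphism loc_inj.
Proof.
move=> a b; apply/esym; rewrite /loc_inj.
rewrite [- _]frac_opp [_ + _]frac_add.
by apply/frac_eqP; exists 1; [apply: mset1 | ring].
Qed.

Lemma loc_inj_is_monoid_morphism : monoid_morphism loc_inj.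
Proof.
split=> [//|a b]; apply/esym; rewrite /loc_inj [_ * _]frac_mul.
by apply/frac_eqP; exists 1; [apply: mset1 | ring].
Qed.

HB.instance Definition _ :=
  GRing.isZmodMorphism.Build S loc loc_inj loc_inj_is_zmod_morphism.
HB.instance Definition _ :=
  GRing.isMonoidMorphism.Build S loc loc_inj loc_inj_is_monoid_morphism.

End Localization.

(** * Graded rings, Proj, and the global sections of O(n) *)

(* [gr d] is the set of homogeneous elements of degree d (0 included). *)
Record grading (S : comNzRingType) := Grading {
  gr :> nat -> S -> Prop;
  gr0 : forall d, gr d 0;
  grB : forall d a b, gr d a -> gr d b -> gr d (a - b);
  gr1 : gr 0%N 1;
  grM : forall d e a b, gr d a -> gr e b -> gr (d + e)%N (a * b);
  gr_span : forall a, exists n (c : nat -> S),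
    (forall d, gr d (c d)) /\ a = \sum_(d < n) c d;
  gr_free : forall n (c : nat -> S), (forall d, gr d (c d)) ->
    \sum_(d < n) c d = 0 -> forall d : 'I_n, c d = 0 }.

Section Proj.
Variables (S : comNzRingType) (G : grading S).

(* [hideal_homog]: the homogeneous components of the elements of I are in I. *)
Record homog_ideal (I : S -> Prop) : Prop := HomogIdeal {
  hideal0 : I 0;
  hidealD : forall a b, I a -> I b -> I (a + b);
  hidealM : forall a b, I b -> I (a * b);
  hideal_homog : forall n (c : nat -> S), (forall d, G d (c d)) ->
    I (\sum_(d < n) c d) -> forall d : 'I_n, I (c d) }.

Record proj_point := ProjPoint {
  pideal :> S -> Prop;
  pidealP : homog_ideal pideal;
  pideal1 : ~ pideal 1;
  pideal_prime : forall a b, pideal (a * b) -> pideal a \/ pideal b;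
  pideal_relevant : exists d f, [/\ (0 < d)%N, G d f & ~ pideal f] }.

Implicit Types (x y : proj_point) (Z U : proj_point -> Prop).

Definition zclosed Z : Prop :=
  exists2 I, homog_ideal I & forall x, Z x <-> (forall a, I a -> x a).

Definition zopen U : Prop := zclosed (fun x => ~ U x).

Definition zirreducible Z : Prop :=
  (exists x, Z x) /\
  forall Z1 Z2, zclosed Z1 -> zclosed Z2 ->
    (forall x, Z x -> Z1 x \/ Z2 x) ->
    (forall x, Z x -> Z1 x) \/ (forall x, Z x -> Z2 x).

Definition zchain (l : nat) (C : nat -> proj_point -> Prop) : Prop :=
  (forall i, (i <= l)%N -> zclosed (C i) /\ zirreducible (C i)) /\
  (forall i, (i < l)%N ->
     (forall x, C i x -> C i.+1 x) /\ exists2 x, C i.+1 x & ~ C i x).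

(* Krull dimension: the supremum of the lengths of the chains of irreducible
   closed subsets. *)
Definition proj_dim_is (l : nat) : Prop :=
  (exists C, zchain l C) /\ (forall m C, zchain m C -> (m <= l)%N).

Definition hcompl_set x (f : S) : Prop := (exists d, G d f) /\ ~ x f.

Lemma hcompl1 x : hcompl_set x 1.
Proof. by split; [exists 0%N; apply: gr1 | apply: pideal1]. Qed.

Lemma hcomplM x f g : hcompl_set x f -> hcompl_set x g -> hcompl_set x (f * g).
Proof.
move=> [[d Gf] xf] [[e Gg] xg]; split; first by exists (d + e)%N; apply: grM.
by move=> /pideal_prime[].
Qed.

Definition hcompl x : mulset S := MulSet (hcompl1 x) (@hcomplM x).

(* The graded ring of fractions of S by the homogeneous elements outside x;
   the stalk of O(n) at x is its part of degree n. *)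
Definition hloc x := loc (hcompl x).

(* Families of elements of the rings [hloc x], with pointwise operations.  The
   sections of all the sheaves O(n) live here, so that the product
   O(m) x O(n) -> O(m + n) is the product of this ring. *)
Definition germs : Type := forall x, hloc x.

HB.instance Definition _ := gen_eqMixin germs.
HB.instance Definition _ := gen_choiceMixin germs.

Implicit Types s t : germs.

Lemma germsP s t : (forall x, s x = t x) -> s = t.
Proof. exact: functional_extensionality_dep. Qed.

Definition germs0 : germs := fun=> 0.
Definition germs1 : germs := fun=> 1.
Definition germs_opp s : germs := fun x => - s x.
Definition germs_add s t : germs := fun x => s x + t x.
Definition germs_mul s t : germs := fun x => s x * t x.

Lemma germs_addA : associative germs_add.
Proof. by move=> s t u; apply: germsP => x; apply: addrA. Qed.
Lemma germs_addC : commutative germs_add.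
Proof. by move=> s t; apply: germsP => x; apply: addrC. Qed.
Lemma germs_add0 : left_id germs0 germs_add.
Proof. by move=> s; apply: germsP => x; apply: add0r. Qed.
Lemma germs_addN : left_inverse germs0 germs_opp germs_add.
Proof. by move=> s; apply: germsP => x; apply: addNr. Qed.

HB.instance Definition _ :=
  GRing.isZmodule.Build germs germs_addA germs_addC germs_add0 germs_addN.

Lemma germs_mulA : associative germs_mul.
Proof. by move=> s t u; apply: germsP => x; apply: mulrA. Qed.
Lemma germs_mulC : commutative germs_mul.
Proof. by move=> s t; apply: germsP => x; apply: mulrC. Qed.
Lemma germs_mul1 : left_id germs1 germs_mul.
Proof. by move=> s; apply: germsP => x; apply: mul1r. Qed.
Lemma germs_mulD : left_distributive germs_mul +%R.
Proof. by move=> s t u; apply: germsP => x; apply: mulrDl. Qed.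

HB.instance Definition _ := GRing.Zmodule_isComPzRing.Build germs
  germs_mulA germs_mulC germs_mul1 germs_mulD.

(* s is a global section of O(n), n >= 0: locally on Proj S it is a/f with a
   and f homogeneous, deg a = deg f + n, and f vanishing nowhere. *)
Definition twist_section (n : nat) s : Prop :=
  forall x, exists U, [/\ zopen U, U x &
    exists d a f, [/\ G d f, G (d + n)%N a &
      forall y, U y -> exists yf : hcompl y f, s y = frac a yf]].

Definition germs_of (a : S) : germs := fun=> loc_inj _ a.

Lemma germs_of_is_zmod_morphism : zmod_morphism germs_of.
Proof. by move=> a b; apply: germsP => x; apply: rmorphB. Qed.

Lemma germs_of_is_monoid_morphism : monoid_morphism germs_of.
Proof.
split; first by apply: germsP => x; apply: rmorph1.
by move=> a b; apply: germsP => x; apply: rmorphM.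
Qed.

HB.instance Definition _ :=
  GRing.isZmodMorphism.Build S germs germs_of germs_of_is_zmod_morphism.
HB.instance Definition _ :=
  GRing.isMonoidMorphism.Build S germs germs_of germs_of_is_monoid_morphism.

Lemma germs_nonzero : proj_point -> 1 != 0 :> germs.
Proof.
move=> x; apply/eqP => /(congr1 (fun s : germs => s x)) e.
have [h [_ xh]] := (frac_eqP 1 0 (mset1 (hcompl x)) (mset1 (hcompl x))).1 e.
rewrite mul0r mulr0 !mulr1 => h0; apply: xh; rewrite h0.
exact: hideal0 (pidealP x).
Qed.

End Proj.

(** * The double line *)

Section DoubleLine.
Variable k : fieldType.

Local Notation P2 := {mpoly k[3]}.

Definition o1 : 'I_3 := @Ordinal 3 1 isT.

Definition dline_ideal (f : P2) : bool :=
  `[< exists g : P2, f = g * 'X_o1 ^+ 2 >].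

Lemma dline_idealP (f : P2) :
  reflect (exists g : P2, f = g * 'X_o1 ^+ 2) (f \in dline_ideal).
Proof. exact: asboolP. Qed.

(* Restriction to the line over the point [1 : 0 : 0]; used to show that
   (x1^2) is a proper ideal and that the double line is not empty. *)
Let h100 (i : 'I_3) : {poly k} := if i == ord0 then 'X else 0.
Let ev (f : P2) : {poly k} := mmap polyC h100 f.

Let evD f g : ev (f + g) = ev f + ev g. Proof. exact: mmapD. Qed.
Let evM f g : ev (f * g) = ev f * ev g. Proof. exact: rmorphM. Qed.
Let ev1 : ev 1 = 1. Proof. exact: rmorph1. Qed.

Let ev_ideal f : f \in dline_ideal -> ev f = 0.
Proof.
move=> /dline_idealP[g ->]; rewrite expr2 !evM.
by rewrite [ev 'X_o1]mmapX mmap1U mulr0 mulr0.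
Qed.

Lemma dline_ideal_closed : idealr_closed dline_ideal.
Proof.
split=> [||a f g /dline_idealP[u ->] /dline_idealP[v ->]].
- by apply/dline_idealP; exists 0; rewrite mul0r.
- by apply/negP => /ev_ideal; rewrite ev1 => /eqP; rewrite oner_eq0.
- by apply/dline_idealP; exists (a * u + v); rewrite mulrDl mulrA.
Qed.

HB.instance Definition _ := isIdealr.Build P2 dline_ideal dline_ideal_closed.

(* k[x0, x1, x2] / (x1^2), with x_i the indeterminate 'X_i. *)
Definition dline_ring : Type := {ideal_quot (dline_ideal : idealr P2)}.
HB.instance Definition _ := GRing.ComNzRing.on dline_ring.

Definition dline_pi (f : P2) : dline_ring := \pi_({ideal_quot (dline_ideal : idealr P2)}) f.

Lemma dline_pi_is_zmod_morphism : zmod_morphism dline_pi.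
Proof. by move=> f g; rewrite /dline_pi rmorphB. Qed.
Lemma dline_pi_is_monoid_morphism : monoid_morphism dline_pi.
Proof. by split=> [|f g]; rewrite /dline_pi ?rmorph1 ?rmorphM. Qed.

HB.instance Definition _ :=
  GRing.isZmodMorphism.Build P2 dline_ring dline_pi dline_pi_is_zmod_morphism.
HB.instance Definition _ := GRing.isMonoidMorphism.Build P2 dline_ring dline_pi
  dline_pi_is_monoid_morphism.

Definition dline_deg (d : nat) (a : dline_ring) : Prop :=
  exists2 f : P2, f \is d.-homog & a = dline_pi f.

Lemma dline_pi_surj a : exists f, a = dline_pi f.
Proof. by exists (repr a); rewrite /dline_pi reprK. Qed.

Lemma dline_pi_eq0 f : dline_pi f = 0 <-> f \in dline_ideal.
Proof.
have E : (f \in dline_ideal) = (dline_pi f == dline_pi 0).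
  by rewrite -[f in LHS]subr0 (@Quotient.idealrBE P2 (dline_ideal : idealr P2)).
by rewrite -(rmorph0 dline_pi) E; split=> [->|/eqP].
Qed.

Let pihomog_ideal d f :
  f \in dline_ideal -> pihomog mdeg d f \in dline_ideal.
Proof.
move=> /dline_idealP[g ->].
rewrite (pihomog_partitionE (leqnn (mmeasure mdeg g))) mulr_suml raddf_sum /=.
apply: rpred_sum => e _.
have He : pihomog mdeg e g * 'X_o1 ^+ 2 \is (e + 1 * 2)%N.-homog.
  apply: dhomogM; first exact: pihomogP.
  by apply: dhomogMn; rewrite dhomogX; apply/eqP/mdeg1.
have [<-|ne] := eqVneq (e + 1 * 2)%N d.
  by rewrite (pihomog_dE He); apply/dline_idealP; eexists.
by rewrite (pihomog_ne0 ne He) rpred0.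
Qed.

Lemma dline_deg0 d : dline_deg d 0.
Proof. by exists 0; rewrite ?rmorph0 // dhomog0. Qed.

Lemma dline_degB d a b : dline_deg d a -> dline_deg d b -> dline_deg d (a - b).
Proof.
by move=> [f Hf ->] [g Hg ->]; exists (f - g); rewrite ?rmorphB ?rpredB.
Qed.

Lemma dline_deg1 : dline_deg 0 1.
Proof. by exists 1; rewrite ?rmorph1 ?dhomog1. Qed.

Lemma dline_degM d e a b :
  dline_deg d a -> dline_deg e b -> dline_deg (d + e) (a * b).
Proof.
by move=> [f Hf ->] [g Hg ->]; exists (f * g); rewrite ?rmorphM ?dhomogM.
Qed.

Lemma dline_deg_span a : exists n (c : nat -> dline_ring),
  (forall d, dline_deg d (c d)) /\ a = \sum_(d < n) c d.
Proof.
have [f ->] := dline_pi_surj a.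
exists (mmeasure mdeg f), (fun d => dline_pi (pihomog mdeg d f)); split.
  by move=> d; eexists; first exact: pihomogP.
by rewrite {1}(pihomog_partitionE (leqnn (mmeasure mdeg f))) rmorph_sum.
Qed.

Lemma dline_deg_free n (c : nat -> dline_ring) :
  (forall d, dline_deg d (c d)) -> \sum_(d < n) c d = 0 ->
  forall d : 'I_n, c d = 0.
Proof.
move=> Hc; have {Hc} [f Hf] : {f : nat -> P2 &
    forall d, f d \is d.-homog /\ c d = dline_pi (f d)}.
  apply: (@boolp.choice nat P2
    (fun d g => g \is d.-homog /\ c d = dline_pi g)).
  by move=> d; have [g] := Hc d; exists g.
move=> H0 d; have [Hd ->] := Hf d; apply/dline_pi_eq0.
have : \sum_(e < n) f e \in dline_ideal.
  apply/dline_pi_eq0; rewrite rmorph_sum -[RHS]H0.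
  by apply: eq_bigr => e _; rewrite (Hf e).2.
move=> /(pihomog_ideal d); rewrite raddf_sum (bigD1 d) //= pihomog_dE //.
rewrite big1 ?addr0 // => e ne; apply: (@pihomog_ne0 _ _ _ e).
  by [].
exact: (Hf e).1.
Qed.

Definition dline_grading : grading dline_ring :=
  Grading dline_deg0 dline_degB dline_deg1 dline_degM dline_deg_span
    dline_deg_free.

Definition dline : Type := proj_point dline_grading.

(** The double line is not empty. *)

Let evq (a : dline_ring) : {poly k} := ev (repr a).

Let evq_pi f : evq (dline_pi f) = ev f.
Proof.
apply/eqP; rewrite -subr_eq0 -[_ - _]mmapB; apply/eqP/ev_ideal.
by rewrite -dline_pi_eq0 rmorphB /= [dline_pi (repr _)]reprK subrr.
Qed.

Let evqD a b : evq (a + b) = evq a + evq b.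
Proof.
have [f ->] := dline_pi_surj a; have [g ->] := dline_pi_surj b.
by rewrite -rmorphD !evq_pi evD.
Qed.

Let evqM a b : evq (a * b) = evq a * evq b.
Proof.
have [f ->] := dline_pi_surj a; have [g ->] := dline_pi_surj b.
by rewrite -rmorphM !evq_pi evM.
Qed.

Let evq0 : evq 0 = 0.
Proof. by rewrite -(rmorph0 dline_pi) evq_pi; apply: mmap0. Qed.

Let evq_deg d a : dline_deg d a -> exists c : k, evq a = c *: 'X^d.
Proof.
move=> [f Hf ->]; rewrite evq_pi /ev /mmap big_seq.
elim/big_rec: _ => [|m p mf [c ->]]; first by exists 0; rewrite scale0r.
have <- := dhomog_mf Hf mf.
have [c' ->] : exists c', mmap1 h100 m = c' *: 'X^(mdeg m).
  rewrite mdegE /mmap1; elim/big_rec2: _ => [|i e q _ [c' ->]].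
    by exists 1; rewrite scale1r.
  rewrite /h100; have [_|_] := eqVneq i ord0.
    by exists c'; rewrite exprD -scalerAr.
  case: (m i) => [|j]; first by exists c'; rewrite expr0 mul1r.
  by exists 0; rewrite expr0n /= mul0r scale0r.
by exists (f@_m * c' + c); rewrite mul_polyC scalerA scalerDl.
Qed.

Lemma dline_nonempty : dline.
Proof.
apply: (@ProjPoint _ dline_grading (fun a => evq a = 0)).
- split=> [//|a b||n c Hc].
  + by rewrite evqD => -> ->; rewrite addr0.
  + by move=> a b e; rewrite evqM e mulr0.
  + have -> : evq (\sum_(d < n) c d) = \sum_(d < n) evq (c d).
      exact: (big_morph evq evqD evq0).
    move=> H d; have [u Hu] := evq_deg (Hc d).
    move/(congr1 (fun p : {poly k} => p`_d)): H; rewrite coef_sum (bigD1 d) //=.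
    rewrite big1 => [|e ne]; last first.
      have [v ->] := evq_deg (Hc e).
      by rewrite coefZ coefXn eq_sym (negPf (_ : _ != _ :> nat)) ?mulr0.
    by rewrite addr0 Hu coef0 coefZ coefXn eqxx mulr1 => ->; rewrite scale0r.
- by rewrite -(rmorph1 dline_pi) evq_pi ev1; apply/eqP/oner_neq0.
- move=> a b; rewrite evqM => /eqP; rewrite mulf_eq0.
  by case/orP=> /eqP; [left | right].
- exists 1%N, (dline_pi 'X_ord0); split=> //.
    by exists 'X_ord0 => //; rewrite dhomogX; apply/eqP/mdeg1.
  rewrite evq_pi /ev mmapX mmap1U /h100 eqxx.
  by apply/eqP; rewrite polyX_eq0.
Qed.

(* The ring [germs] of the double line, as a k-algebra. *)
Definition dline_germs : Type := germs dline_grading.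
HB.instance Definition _ := GRing.ComPzRing.on dline_germs.
HB.instance Definition _ := GRing.PzSemiRing_isNonZero.Build dline_germs
  (germs_nonzero dline_nonempty).

Definition dline_const (c : k) : dline_germs :=
  (germs_of (dline_pi c%:MP) : germs dline_grading).

Lemma dline_constD : {morph dline_const : a b / a + b}.
Proof. by move=> a b; rewrite /dline_const mpolyCD !rmorphD. Qed.
Lemma dline_constM : {morph dline_const : a b / a * b}.
Proof. by move=> a b; rewrite /dline_const mpolyCM !rmorphM. Qed.
Lemma dline_const1 : dline_const 1 = 1.
Proof. by rewrite /dline_const !rmorph1. Qed.

Definition dline_scale (c : k) (s : dline_germs) := dline_const c * s.

Lemma dline_scaleA a b s :
  dline_scale a (dline_scale b s) = dline_scale (a * b) s.
Proof. by rewrite /dline_scale mulrA dline_constM. Qed.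
Lemma dline_scale1 : left_id 1 dline_scale.
Proof. by move=> s; rewrite /dline_scale dline_const1 mul1r. Qed.
Lemma dline_scaleDr : right_distributive dline_scale +%R.
Proof. by move=> c s t; rewrite /dline_scale mulrDr. Qed.
Lemma dline_scaleDl s : {morph dline_scale^~ s : a b / a + b}.
Proof. by move=> a b; rewrite /dline_scale dline_constD mulrDl. Qed.

HB.instance Definition _ := GRing.Zmodule_isLmodule.Build k dline_germs
  dline_scaleA dline_scale1 dline_scaleDr dline_scaleDl.

Lemma dline_scaleAl (c : k) (s t : dline_germs) : c *: (s * t) = (c *: s) * t.
Proof. exact: mulrA. Qed.

HB.instance Definition _ :=
  GRing.Lmodule_isLalgebra.Build k dline_germs dline_scaleAl.
HB.instance Definition _ := GRing.Lalgebra_isComAlgebra.Build k dline_germs.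

End DoubleLine.

(** * Graded linear series *)

Section Series.
Variables (k : fieldType) (A : comAlgType k).

(* V is meant to be a k-subspace; V then has dimension d. *)
Definition dim_is (V : A -> Prop) (d : nat) : Prop :=
  exists b : 'I_d -> A, [/\ forall i, V (b i),
    forall c : 'I_d -> k, \sum_i c i *: b i = 0 -> forall i, c i = 0 &
    forall v, V v -> exists c : 'I_d -> k, v = \sum_i c i *: b i].

(* Let [Gam n] be subspaces of A with Gam m * Gam n in Gam (m + n).  The ring
   \bigoplus_n Gam n is encoded as the set of the polynomials over A whose
   coefficient of degree n is in [Gam n], for all n. *)
Variable Gam : nat -> A -> Prop.
Implicit Types (L : {poly A} -> Prop) (P Q : {poly A}).

Definition section_ring P : Prop := forall n, Gam n P`_n.

Record graded_subalgebra L : Prop := GradedSubalgebra {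
  gsub_section : forall P, L P -> section_ring P;
  gsub1 : L 1;
  gsubD : forall P Q, L P -> L Q -> L (P + Q);
  gsubM : forall P Q, L P -> L Q -> L (P * Q);
  gsubZ : forall (c : k) P, L P -> L (c%:A *: P);
  gsub_graded : forall P n, L P -> L (P`_n *: 'X^n) }.

Definition graded_piece L (n : nat) (s : A) : Prop := L (s *: 'X^n).

Definition homog_pos P : Prop := exists n s, (0 < n)%N /\ P = s *: 'X^n.

Definition alg_indep m (y : 'I_m -> {poly A}) : Prop :=
  forall p : {mpoly k[m]}, mmap (fun c : k => (c%:A)%:P) y p = 0 -> p = 0.

Definition has_indep L (m : nat) : Prop :=
  exists y : 'I_m -> {poly A},
    (forall i, L (y i) /\ homog_pos (y i)) /\ alg_indep y.

(* The first disjunct gives the value 0 when no nonempty independent family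
   exists. *)
Definition sigma_is L (m : nat) : Prop :=
  (m = 0%N \/ has_indep L m) /\ forall m', has_indep L m' -> (m' <= m)%N.

Variant kodaira_value := KNegInfty | KFin of nat.

Definition kodaira_of_sigma (m : nat) : kodaira_value :=
  if m is m'.+1 then KFin m' else KNegInfty.

Definition kodaira_iitaka_is L (q : kodaira_value) : Prop :=
  exists2 m, sigma_is L m & q = kodaira_of_sigma m.

End Series.

(* A graded linear series for O_X(e), X the double line: the n-th tensor power
   of O_X(e) is O_X(e * n), as the coordinate ring is generated in degree 1. *)
Definition dline_series (k : fieldType) (e : nat)
    (L : {poly dline_germs k} -> Prop) : Prop :=
  graded_subalgebra
    (fun n (s : dline_germs k) => twist_section (e * n) s) L.

(* Main.v *)
(** Every section X_1 g of O(2n) is square-zero with every other, because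
    X_1^2 = 0; so spans of such sections, chosen freely in each degree, form a
    graded subalgebra all of whose homogeneous elements of positive degree are
    nilpotent, and the forms g of degree 2n - 1 in X_0, X_2 leave room for
    n + 1 independent sections X_1 X_0^i X_2^(2n-1-i).  They are independent
    already at the generic point (X_1).
    For the dimension, an irreducible closed set is the closure of its generic
    point, and a chain of three distinct relevant homogeneous primes would
    dehomogenize to a chain of three primes of k[t]. *)

Require Import Defs.
From HB Require Import structures.
From mathcomp Require Import all_boot all_order all_algebra.
From mathcomp Require Import boolp ring mpoly.

Set Implicit Arguments.
Unset Strict Implicit.
Unset Printing Implicit Defensive.

Import GRing.Theory.
Local Open Scope ring_scope.

(** * Irreducible closed subsets of Proj, generic points and dimension *)

Section ProjClosedSets.
Variables (S : comNzRingType) (G : grading S).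
Implicit Types (x y : proj_point G) (Z : proj_point G -> Prop).

Lemma pideal_sum x n (c : nat -> S) :
  (forall i, (i < n)%N -> x (c i)) -> x (\sum_(i < n) c i).
Proof.
by move=> H; elim/big_ind: _ => [|a b|i _];
  [exact: (hideal0 (pidealP x)) | exact: (hidealD (pidealP x)) | exact: H].
Qed.

Lemma pidealMl x a b : x b -> x (a * b).
Proof. exact: hidealM (pidealP x) _ _. Qed.

Lemma pideal_exp x a n : x (a ^+ n) -> x a.
Proof.
elim: n => [|n IHn]; first by move/(pideal1 (p := x)).
by rewrite exprS => /pideal_prime[].
Qed.

(** Some homogeneous component of an element of [x] outside [y] is itself outside [y], and it stays
    in [x] because [x] is homogeneous. Noninclusions are thus witnessed by forms, which can be
    dehomogenized. *)
Lemma proj_point_witness x y : ~ (forall a, x a -> y a) ->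
  exists d a, [/\ G d a, x a & ~ y a].
Proof.
move=> /existsNP[a /not_implyP[xa nya]]; apply: contrapT => nH; apply: nya.
have [n [c [Gc aE]]] := gr_span G a; rewrite aE; apply: pideal_sum => i lt_in.
apply: contrapT => nyc; apply: nH; exists i, (c i); split=> //.
by rewrite aE in xa; exact: (hideal_homog (pidealP x) Gc xa (Ordinal lt_in)).
Qed.

Lemma zclosed_mem a : zclosed (fun x => x a).
Proof.
(* the homogeneous ideal generated by [a] *)
exists (fun b => forall J, homog_ideal G J -> J a -> J b).
  split=> [J HJ _|b c Hb Hc J HJ Ja|b c Hc J HJ Ja|n c Gc Hc d J HJ Ja].
  - exact: hideal0 HJ.
  - by apply: (hidealD HJ); [apply: Hb | apply: Hc].
  - by apply: (hidealM HJ); apply: Hc.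
  - by apply: (hideal_homog HJ Gc); apply: Hc.
move=> x; split=> [xa b Hb|]; first exact: Hb (pidealP x) xa.
by apply=> J _.
Qed.

Lemma zopenT : zopen (fun _ : proj_point G => True).
Proof.
exists (fun=> True); first by split.
by move=> x; split=> [//|/(_ 1 I)/(pideal1 (p := x))].
Qed.

Definition closure_pt x : proj_point G -> Prop := fun y => forall a, x a -> y a.

Lemma zclosed_closure_pt x : zclosed (closure_pt x).
Proof. by exists x; first exact: pidealP. Qed.

(** Whichever of the two closed sets contains [x] contains its whole closure. *)
Lemma zirreducible_closure_pt x : zirreducible (closure_pt x).
Proof.
split; first by exists x.
move=> Z1 Z2 [I1 _ Z1E] [I2 _ Z2E] /(_ x (fun _ => id))[/Z1E|/Z2E] I12x.
  by left=> y xy; apply/Z1E => a /I12x/xy.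
by right=> y xy; apply/Z2E => a /I12x/xy.
Qed.

(** The generic point is the ideal [I] of the elements lying in every point of [Z]. A single point
    of [Z] makes [I] proper and relevant. *)
Lemma zirreducible_generic Z : zclosed Z -> zirreducible Z ->
  exists x, forall y, Z y <-> closure_pt x y.
Proof.
move=> [J _ ZE] [[z Zz] Zirr].
pose I a := forall y, Z y -> y a.
have HI : homog_ideal G I.
  split=> [y _|a b Ia Ib y Zy|a b Ib y Zy|n c Gc Ic d y Zy].
  - exact: hideal0 (pidealP y).
  - by apply: (hidealD (pidealP y)); [apply: Ia | apply: Ib].
  - by apply: pidealMl; apply: Ib.
  - exact: (hideal_homog (pidealP y) Gc (Ic y Zy)).
have I1 : ~ I 1 by move=> /(_ z Zz)/(pideal1 (p := z)).
have Iprime a b : I (a * b) -> I a \/ I b.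
  (* [Z] is covered by the loci of [a] and [b], so irreducibility puts it inside one of them. *)
  move=> Iab; apply: (Zirr _ _ (zclosed_mem a) (zclosed_mem b)) => y Zy.
  by apply: pideal_prime; apply: Iab.
have Irel : exists d f, [/\ (0 < d)%N, G d f & ~ I f].
  have [d [f [d0 Gf zf]]] := pideal_relevant z.
  by exists d, f; split=> // /(_ z Zz).
exists (ProjPoint HI I1 Iprime Irel) => y; split=> [Zy a /(_ y Zy) //|xy].
by apply/ZE => a Ja; apply: xy => w /ZE/(_ a Ja).
Qed.

(** Taking closures reverses inclusions: a chain of length at least 2 yields, through generic
    points, primes [y2], [y1], [y0] increasing strictly, which the last hypothesis forbids. *)
Lemma proj_dim_is1 x0 x1 :
    (forall a, x1 a -> x0 a) -> ~ (forall a, x0 a -> x1 a) ->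
    (forall y0 y1 y2, (forall a, y2 a -> y1 a) -> ~ (forall a, y1 a -> y2 a) ->
       (forall a, y1 a -> y0 a) -> (forall a, y0 a -> y1 a)) ->
  proj_dim_is G 1.
Proof.
move=> x10 nx01 H; split.
  exists (fun i => closure_pt (if i is 0%N then x0 else x1)); split=> [i _|].
    by split; [apply: zclosed_closure_pt | apply: zirreducible_closure_pt].
  case=> // _; split=> [y x0y a /x10/x0y //|].
  by exists x1 => // a.
move=> m C [Cirr Cinc]; rewrite leqNgt; apply/negP => m_gt1.
have gen i : (i <= m)%N -> exists x, forall y, C i y <-> closure_pt x y.
  by case/Cirr => Ccl Ci; apply: zirreducible_generic.
have le1m : (1 <= m)%N by apply: leq_trans m_gt1.
have [y0 C0] := gen 0%N isT; have [y1 C1] := gen 1%N le1m.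
have [y2 C2] := gen 2%N m_gt1.
have [C01 [z1 C1z1 nC0z1]] := Cinc 0%N le1m.
have [C12 [z2 C2z2 nC1z2]] := Cinc 1%N m_gt1.
have y10 : closure_pt y1 y0 by apply/C1/C01/C0.
have y21 : closure_pt y2 y1 by apply/C2/C12/C1.
have n12 : ~ (forall a, y1 a -> y2 a).
  by move=> y12; apply/nC1z2/C1 => a /y12; apply: (C2 z2).1.
(* The equality of [y0] and [y1] would force [z1], a point of [C 1], into [C 0]. *)
apply/nC0z1/C0 => a /(H _ _ _ y21 n12 y10); exact: (C1 z1).1.
Qed.

End ProjClosedSets.

(** * Setting variables to zero in a polynomial ring *)

Section KillVariables.
Variables (n : nat) (R : comNzRingType).
Implicit Types (A : pred 'I_n) (f g : {mpoly R[n]}) (m : 'X_{1.. n}).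

Lemma dhomog_Xn i d : ('X_i ^+ d : {mpoly R[n]}) \is d.-homog.
Proof.
by rewrite -[X in X.-homog]mul1n dhomogMn // dhomogX; apply/eqP/mdeg1.
Qed.

Definition kill_var A (i : 'I_n) : {mpoly R[n]} := if A i then 0 else 'X_i.

(** An endomorphism whose kernel is the ideal generated by the variables in [A]; over a field this
    ideal is prime because the target is a domain. *)
Definition kill A : {mpoly R[n]} -> {mpoly R[n]} :=
  mmap (@mpolyC n R) (kill_var A).

HB.instance Definition _ A :=
  GRing.RMorphism.copy (kill A) (mmap (@mpolyC n R) (kill_var A)).

Lemma kill_U A i : kill A 'X_i = if A i then 0 else 'X_i.
Proof. by rewrite /kill mmapX mmap1U. Qed.

Lemma killZ A c f : kill A (c *: f) = c *: kill A f.
Proof. by rewrite /kill mmapZ mul_mpolyC. Qed.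

Lemma dhomog_kill A d f : f \is d.-homog -> kill A f \is d.-homog.
Proof.
move=> Hf; rewrite [kill A f]big_seq rpred_sum // => m mf.
rewrite mul_mpolyC rpredZ // -(dhomog_mf Hf mf) /= mdegE /mmap1.
elim/big_rec2: _ => [|i e p _ He]; first exact: dhomog1.
apply: dhomogM => //; rewrite /kill_var; case: (A i).
  by case: (m i) => [|j]; rewrite ?expr0 ?dhomog1 // exprS mul0r dhomog0.
exact: dhomog_Xn.
Qed.

Lemma mpolyX_dvd m i : (0 < m i)%N ->
  'X_[m] = 'X_[m - U_(i)] * 'X_i :> {mpoly R[n]}.
Proof. by move=> mi; rewrite -mpolyXD submK // lep1mP -lt0n. Qed.

Lemma kill1_id m i : m i = 0%N -> kill (pred1 i) 'X_[m] = 'X_[m].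
Proof.
move=> mi; rewrite /kill mmapX [RHS]mpolyXE_id; apply: eq_bigr => j _.
by rewrite /kill_var /=; case: eqP => // ->; rewrite mi !expr0.
Qed.

(** A monomial free of ['X_i] is fixed; any other one is killed and is a multiple of ['X_i]. *)
Lemma kill1_sub i f : exists g, f - kill (pred1 i) f = g * 'X_i.
Proof.
elim/mpolyind: f => [|c m p _ _ [g Hg]].
  by exists 0; rewrite rmorph0 subr0 mul0r.
have [u Hu] : exists u, 'X_[m] - kill (pred1 i) 'X_[m] = u * 'X_i.
  have [mi|mi] := posnP (m i); first by exists 0; rewrite kill1_id // subrr mul0r.
  exists 'X_[m - U_(i)].
  by rewrite (mpolyX_dvd mi) rmorphM /= kill_U /= eqxx mulr0 subr0.
exists (c *: u + g); rewrite rmorphD /= killZ opprD addrACA -scalerBr Hu Hg.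
by rewrite mulrDl scalerAl.
Qed.

Lemma kill1_eq0 i f : kill (pred1 i) f = 0 <-> exists g, f = g * 'X_i.
Proof.
split=> [f0|[g ->]]; last by rewrite rmorphM /= kill_U /= eqxx mulr0.
by have [g] := kill1_sub i f; rewrite f0 subr0; exists g.
Qed.

End KillVariables.

(** Dividing [q] by its gcd with [b] stays inside the prime [p], since the gcd divides [b] and so
    avoids [p]; the size drops until the two are coprime. With Bezout this is the maximality of
    nonzero primes of F[t]. *)
Lemma prime_coprimep (F : fieldType) (p : {poly F} -> Prop) :
    (forall q r, p r -> p (q * r)) ->
    (forall q r, p (q * r) -> p q \/ p r) ->
  forall q b, q != 0 -> p q -> ~ p b -> exists2 r, p r & coprimep r b.
Proof.
move=> pM pprime q b; have [s] := ubnP (size q).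
elim: s q => // s IHs q /ltnSE le_qs q0 pq npb.
have [cqb|ncqb] := boolP (coprimep q b); first by exists q.
set d := gcdp q b; have d0 : d != 0 by rewrite gcdp_eq0 (negPf q0).
have qE : q = (q %/ d) * d by rewrite divpK ?dvdp_gcdl.
have qd0 : q %/ d != 0 by apply: contraNneq q0 => qd0; rewrite qE qd0 mul0r.
have [pqd|pd] : p (q %/ d) \/ p d by apply: pprime; rewrite -qE.
  apply: (IHs (q %/ d)) => //; apply: leq_trans le_qs; rewrite size_divp //.
  have d1 : (1 < size d)%N.
    by move: ncqb d0; rewrite /coprimep -/d -size_poly_eq0; case: size => [|[]].
  have q1 : (0 < size q)%N by rewrite size_poly_gt0.
  by rewrite ltn_subrL q1 andbT; case: size d1 => [|[]].
by case: npb; rewrite -(divpK (dvdp_gcdr q b)); apply: pM.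
Qed.

(** * Points of the double line and its dimension *)

Section DoubleLinePoints.
Variable k : fieldType.
Local Notation P2 := {mpoly k[3]}.
Local Notation o1 := Defs.o1.
Implicit Types (x y : dline k) (f g : P2) (A : pred 'I_3).

Lemma dline_pi_X1_sqr : dline_pi 'X_o1 * dline_pi 'X_o1 = 0 :> dline_ring k.
Proof.
rewrite -rmorphM; apply/dline_pi_eq0/dline_idealP.
by exists 1; rewrite mul1r expr2.
Qed.

Section KillPoint.
Variable A : pred 'I_3.
Hypothesis A1 : A o1.

Definition kill_pideal (a : dline_ring k) : Prop :=
  exists2 f : P2, a = dline_pi f & kill A f = 0.

(** Two lifts differ by a multiple of ['X_o1 ^+ 2], which [kill A] annihilates, so the choice of the
    lift is immaterial. *)
Lemma kill_pidealE f : kill_pideal (dline_pi f) <-> kill A f = 0.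
Proof.
split=> [[g fg g0]|]; last by exists f.
have /dline_pi_eq0/dline_idealP[u Hu] : dline_pi (f - g) = 0.
  by rewrite rmorphB /= fg subrr.
apply/eqP; rewrite -[f](subrK g) rmorphD /= g0 addr0 Hu rmorphM rmorphXn /=.
by rewrite kill_U A1 expr0n mulr0.
Qed.

Lemma kill_pideal_homog : homog_ideal (dline_grading k) kill_pideal.
Proof.
split=> [|_ _ [f -> f0] [g -> g0]|a _ [g -> g0]|n c Hc].
- by exists 0; rewrite !rmorph0.
- by exists (f + g); rewrite !rmorphD //= f0 g0 addr0.
- have [f ->] := dline_pi_surj a.
  by exists (f * g); rewrite !rmorphM //= g0 mulr0.
have [f Hf] : {f : nat -> P2 &
    forall d, f d \is d.-homog /\ c d = dline_pi (f d)}.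
  apply: (@boolp.choice nat P2
    (fun d g => g \is d.-homog /\ c d = dline_pi g)).
  by move=> d; have [g] := Hc d; exists g.
rewrite (eq_bigr (fun d : 'I_n => dline_pi (f d))) => [|d _]; last exact: (Hf d).2.
rewrite -rmorph_sum kill_pidealE rmorph_sum /= => H0 d.
rewrite (Hf d).2 kill_pidealE.
(* [kill A] preserves degrees, so the component of degree [d] of the vanishing sum is
   [kill A (f d)]. *)
move/(congr1 (pihomog mdeg d)): H0; rewrite raddf_sum (bigD1 d) //=.
rewrite pihomog_dE ?raddf0; last exact: dhomog_kill (Hf d).1.
rewrite big1 ?addr0 // => e ne; apply: (@pihomog_ne0 _ _ _ e) => //.
exact: dhomog_kill (Hf e).1.
Qed.

Lemma kill_pideal1 : ~ kill_pideal 1.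
Proof.
rewrite -(rmorph1 (@dline_pi k)) kill_pidealE rmorph1.
by apply/eqP/oner_neq0.
Qed.

Lemma kill_pideal_prime a b :
  kill_pideal (a * b) -> kill_pideal a \/ kill_pideal b.
Proof.
have [f ->] := dline_pi_surj a; have [g ->] := dline_pi_surj b.
rewrite -rmorphM !kill_pidealE rmorphM /= => /eqP; rewrite mulf_eq0.
by case/orP=> /eqP; [left | right].
Qed.

Lemma dline_deg_X i : dline_deg 1 (dline_pi 'X_i : dline_ring k).
Proof. by exists 'X_i => //; exact: dhomog_Xn _ i 1. Qed.

Variable i : 'I_3.
Hypothesis Ai : ~~ A i.

Lemma kill_pideal_relevant : exists d a,
  [/\ (0 < d)%N, dline_grading k d a & ~ kill_pideal a].
Proof.
exists 1%N, (dline_pi 'X_i); split=> //; first exact: dline_deg_X.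
rewrite kill_pidealE kill_U (negPf Ai) => /(congr1 (mcoeff U_(i))) /eqP.
by rewrite mcoeffX eqxx mcoeff0 oner_eq0.
Qed.

Definition kill_point : dline k :=
  ProjPoint kill_pideal_homog kill_pideal1 kill_pideal_prime
    kill_pideal_relevant.

End KillPoint.

(** A nilpotent element lies in every prime. *)
Lemma dline_pt_X1 x : x (dline_pi 'X_o1).
Proof.
have : x (dline_pi 'X_o1 * dline_pi 'X_o1).
  by rewrite dline_pi_X1_sqr; exact: (hideal0 (pidealP x)).
by case/pideal_prime.
Qed.

(** Otherwise the prime contains all the variables, hence every form of positive degree, against
    relevance. So the charts x_0 = 1 and x_2 = 1 cover the double line. *)
Lemma dline_pt_var x : exists2 i, i != o1 & ~ x (dline_pi 'X_i).
Proof.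
apply: contrapT => nH.
have xX i : x (dline_pi 'X_i).
  have [->|ne] := eqVneq i o1; first exact: dline_pt_X1.
  by apply: contrapT => nx; apply: nH; exists i.
have [d [_ [d0 [f Hf ->] nxf]]] := pideal_relevant x; apply: nxf.
rewrite (mpolyE f) big_seq rmorph_sum /=.
elim/big_ind: _ => [|a b|m mf].
- exact: (hideal0 (pidealP x)).
- exact: (hidealD (pidealP x)).
have [i mi] : exists i, (0 < m i)%N.
  have := d0; rewrite -(dhomog_mf Hf mf) /= mdegE lt0n sum_nat_eq0 negb_forall.
  by case/existsP => i; rewrite /= -lt0n; exists i.
by rewrite (mpolyX_dvd _ mi) scalerAl rmorphM; exact: (pidealMl _ (xX i)).
Qed.

Section Dehomogenize.
Variable i : 'I_3.
Hypothesis i1 : i != o1.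
(** Since [i] is 0 or 2, reversal gives the third index, distinct from [i] and [o1]. *)
Let j := rev_ord i.

(* The restriction to the affine chart x_i = 1 of the line x_1 = 0. *)
Definition dehom_var (l : 'I_3) : {poly k} :=
  if l == o1 then 0 else if l == i then 1 else 'X.

Definition dehom : P2 -> {poly k} := mmap polyC dehom_var.

HB.instance Definition _ := GRing.RMorphism.copy dehom (mmap polyC dehom_var).

Let ord3 l : l != o1 -> l != i -> l = j.
Proof.
move=> l1 li; apply: val_inj; move: i1 l1 li; rewrite /j -!val_eqE /=.
by case: i l => [[|[|[|//]]] ?] [[|[|[|//]]] ?].
Qed.

Let ji : j != i.
Proof. by move: i1; rewrite /j -!val_eqE /=; case: i => [[|[|[|//]]] ?]. Qed.

Let j1 : j != o1.
Proof. by move: i1; rewrite /j -!val_eqE /=; case: i => [[|[|[|//]]] ?]. Qed.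

Lemma dehom_mmap1 m :
  mmap1 dehom_var m = if m o1 == 0%N then 'X^(m j) else 0.
Proof.
rewrite /mmap1 (bigD1 o1) //= (bigD1 j) //= big1 => [|l /andP[l1 lj]].
  rewrite /dehom_var eqxx (negPf j1) (negPf ji) mulr1 expr0n.
  by case: eqP; rewrite ?mul1r ?mul0r.
have [->|li] := eqVneq l i.
  by rewrite /dehom_var (negPf i1) eqxx expr1n.
by rewrite (ord3 l1 li) eqxx in lj.
Qed.

(** In a fixed degree a monomial free of ['X_o1] is determined by its exponent at [j]. Distinct ones
    therefore go to distinct powers of ['X] and cannot cancel. *)
Lemma dehom_eq0 d f : f \is d.-homog -> dehom f = 0 ->
  exists g, f = g * 'X_o1.
Proof.
move=> Hf f0; have Hm m : m \in msupp f -> (0 < m o1)%N.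
  move=> mf; rewrite lt0n; apply/negP => /eqP m1.
  have := congr1 (fun p : {poly k} => p`_(m j)) f0.
  rewrite /dehom /mmap coef_sum coef0 (bigD1_seq m) ?msupp_uniq //=.
  rewrite coefCM dehom_mmap1 m1 eqxx coefXn eqxx mulr1 big1_seq => [|e].
    by move/eqP; rewrite addr0 mcoeff_eq0 mf.
  case/andP=> ne ef; rewrite coefCM dehom_mmap1; case: eqP => e1; last first.
    by rewrite coef0 mulr0.
  rewrite coefXn; case: eqP => [ej|]; last by rewrite mulr0.
  case/eqP: ne; apply/mnmP.
  (* The exponent at [i] is recovered from the common degree [d]. *)
  have ei : e i = m i.
    have := dhomog_mf Hf ef; rewrite -(dhomog_mf Hf mf) /= !mdegE.
    have E (u : 'X_{1.. 3}) : (\sum_l u l = u o1 + (u i + u j))%N.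
      rewrite (bigD1 o1) //= (bigD1 i) //= (bigD1 j) ?j1 ?ji //= big1 ?addn0 //.
      by move=> l /andP[/andP[l1 li] /eqP[]]; apply: ord3.
    by rewrite !E e1 m1 ej => /addnI/addIn.
  move=> l; have [->|l1] := eqVneq l o1; first by rewrite e1 m1.
  by have [->//|li] := eqVneq l i; rewrite (ord3 l1 li).
apply/kill1_eq0; rewrite (mpolyE f) rmorph_sum /= big_seq big1 // => m mf.
by rewrite (mpolyX_dvd _ (Hm m mf)) scalerAl rmorphM /= kill_U /= mulr0.
Qed.

Lemma dehom_Xi : dehom 'X_i = 1.
Proof. by rewrite /dehom mmapX mmap1U /dehom_var (negPf i1) eqxx. Qed.

(** Homogenization by Horner steps: [q * 'X + c] lifts to ['X_j] times a lift of [q], plus [c] times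
    the power of ['X_i] of matching degree. *)
Lemma dehom_lift q : exists d f, f \is d.-homog /\ dehom f = q.
Proof.
elim/poly_ind: q => [|q c [d [f [Hf fq]]]].
  by exists 0%N, 0; rewrite dhomog0 rmorph0.
exists d.+1, (f * 'X_j + c *: 'X_i ^+ d.+1); split.
  rewrite rpredD //; last by rewrite rpredZ // dhomog_Xn.
  by rewrite -(addn1 d); exact: dhomogM Hf (dhomog_Xn _ j 1).
rewrite rmorphD rmorphM /= fq {2}/dehom mmapZ -/dehom rmorphXn /= dehom_Xi.
rewrite expr1n mulr1; congr (_ * _ + _).
by rewrite /dehom mmapX mmap1U /dehom_var (negPf j1) (negPf ji).
Qed.

Section AffinePrime.
Variable x : dline k.
Hypothesis xi : ~ x (dline_pi 'X_i).

(* The trace of [x] on the affine chart x_i = 1. *)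
Definition affine_pideal (q : {poly k}) : Prop :=
  exists d f, [/\ f \is d.-homog, dehom f = q & x (dline_pi f)].

(** Two forms with the same dehomogenization, brought to one degree by powers of ['X_i], differ by a
    multiple of ['X_o1], which lies in [x]. The power of ['X_i] then cancels because ['X_i] is
    outside the prime. *)
Lemma affine_pidealE d f : f \is d.-homog ->
  affine_pideal (dehom f) -> x (dline_pi f).
Proof.
move=> Hf [e [g [Hg gf xg]]].
have [u Hu] : exists u, 'X_i ^+ e * f - 'X_i ^+ d * g = u * 'X_o1.
  apply: (@dehom_eq0 (d + e)).
    rewrite rpredB //; last exact: dhomogM (dhomog_Xn _ i d) Hg.
    by rewrite addnC; exact: dhomogM (dhomog_Xn _ i e) Hf.
  by rewrite rmorphB !rmorphM !rmorphXn /= dehom_Xi !expr1n !mul1r gf subrr.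
have : x (dline_pi ('X_i ^+ e * f)).
  rewrite -[_ * f](subrK ('X_i ^+ d * g)) Hu rmorphD !rmorphM /=.
  apply: (hidealD (pidealP x)); first exact/pidealMl/dline_pt_X1.
  exact: pidealMl.
by rewrite rmorphM rmorphXn => /pideal_prime[/pideal_exp|].
Qed.

Lemma affine_pidealD q r :
  affine_pideal q -> affine_pideal r -> affine_pideal (q + r).
Proof.
move=> [d [f [Hf <- xf]]] [e [g [Hg <- xg]]].
exists (d + e)%N, ('X_i ^+ e * f + 'X_i ^+ d * g); split.
- rewrite rpredD //; last exact: dhomogM (dhomog_Xn _ i d) Hg.
  by rewrite addnC; exact: dhomogM (dhomog_Xn _ i e) Hf.
- by rewrite rmorphD !rmorphM !rmorphXn /= dehom_Xi !expr1n !mul1r.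
rewrite rmorphD !rmorphM /=.
by apply: (hidealD (pidealP x)); apply: pidealMl.
Qed.

Lemma affine_pidealM q r : affine_pideal r -> affine_pideal (q * r).
Proof.
move=> [e [g [Hg <- xg]]]; have [d [f [Hf <-]]] := dehom_lift q.
exists (d + e)%N, (f * g); rewrite dhomogM // !rmorphM; split=> //.
exact: pidealMl.
Qed.

Lemma affine_pideal_prime q r :
  affine_pideal (q * r) -> affine_pideal q \/ affine_pideal r.
Proof.
have [d [f [Hf <-]]] := dehom_lift q; have [e [g [Hg <-]]] := dehom_lift r.
rewrite -rmorphM => /(affine_pidealE (dhomogM Hf Hg)).
by rewrite rmorphM => /pideal_prime[xf|xg]; [left; exists d, f | right; exists e, g].
Qed.

Lemma affine_pideal1 : ~ affine_pideal 1.
Proof.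
rewrite -(rmorph1 dehom) => /(affine_pidealE (dhomog1 _ _)).
by rewrite rmorph1 => /(pideal1 (p := x)).
Qed.

End AffinePrime.

End Dehomogenize.

(** With [f] in [y1] but not [y2] and [g] in [y0] but not [y1], the trace of [y1] on a chart
    contains some [r] coprime to the trace of [g]; both are in the trace of [y0], so Bezout puts 1
    there. *)
Lemma dline_pt_maximal (y0 y1 y2 : dline k) :
    (forall a, y2 a -> y1 a) -> ~ (forall a, y1 a -> y2 a) ->
  (forall a, y1 a -> y0 a) -> forall a, y0 a -> y1 a.
Proof.
move=> y21 /proj_point_witness[d [_ [[f Hf ->] y1f ny2f]]] y10.
apply: contrapT => /proj_point_witness[e [_ [[g Hg ->] y0g ny1g]]].
have [i i1 y0i] := dline_pt_var y0.
(* The chart is chosen around [y0], the most special point; it then contains [y1] too. *)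
have y1i : ~ y1 (dline_pi 'X_i) by move/y10.
have [|||r [c [u [Hu <- y1u]]] /Bezout_eq1_coprimepP[[v w] /= E]] :=
  @prime_coprimep _ _ (affine_pidealM i1 (x := y1))
    (affine_pideal_prime i1 y1i) (dehom i f) (dehom i g).
(* If [f] dehomogenized to 0, it would be a multiple of ['X_o1] and lie in [y2]. *)
- apply/eqP => /(dehom_eq0 i1 Hf)[h fE]; apply: ny2f.
  by rewrite fE rmorphM; apply/pidealMl/dline_pt_X1.
- by exists d, f.
- by move/(affine_pidealE i1 y1i Hg).
apply: (affine_pideal1 i1 y0i); rewrite -E; apply: (affine_pidealD i1).
  by apply: (affine_pidealM i1); exists c, u; split=> //; apply: y10.
by apply: (affine_pidealM i1); exists e, g.
Qed.

Definition dline_generic : dline k :=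
  @kill_point (pred1 o1) (eqxx o1) ord0 isT.

(* The point [1 : 0 : 0]. *)
Definition dline_closed : dline k :=
  @kill_point (predC1 ord0) isT ord0 isT.

Lemma proj_dim_dline : proj_dim_is (dline_grading k) 1.
Proof.
apply: (@proj_dim_is1 _ _ dline_closed dline_generic).
- move=> _ [f -> /kill1_eq0[g ->]].
  by apply/kill_pidealE => //; rewrite rmorphM /= kill_U mulr0.
(* ['X_ord_max] vanishes at [1 : 0 : 0] but not at the generic point. *)
- move/(_ (dline_pi 'X_ord_max)) => /= H.
  have : kill_pideal (predC1 ord0) (dline_pi 'X_(ord_max : 'I_3)) by
    apply/kill_pidealE; rewrite // kill_U.
  move/H/kill_pidealE => /(_ isT); rewrite kill_U /= => /(congr1 (mcoeff U_(ord_max))).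
  by move/eqP; rewrite mcoeffX eqxx mcoeff0 oner_eq0.
exact: dline_pt_maximal.
Qed.

End DoubleLinePoints.

(** * Graded algebras whose positive part has square zero *)

Section SquareZeroSeries.
Variables (k : fieldType) (A : comAlgType k) (V : nat -> A -> Prop).
Hypotheses (V0 : forall n, V n 0)
  (VD : forall n s t, V n s -> V n t -> V n (s + t))
  (VZ : forall n (c : k) s, V n s -> V n (c *: s))
  (VM : forall m n s t, V m s -> V n t -> s * t = 0).
Implicit Types P Q : {poly A}.

(** The algebra with the scalars in degree 0 and [V n] in each degree n > 0. As products between the
    [V n] vanish, these subspaces may be chosen independently of each other. *)
Definition sqz_series P : Prop :=
  (exists c : k, P`_0 = c%:A) /\ forall n, (0 < n)%N -> V n P`_n.

Lemma sqz_series_piece n s : (0 < n)%N -> graded_piece sqz_series n s <-> V n s.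
Proof.
move=> n0; split=> [[_ /(_ n n0)]|Vs]; first by rewrite coefZ coefXn eqxx mulr1.
split=> [|m m0]; rewrite coefZ coefXn.
  by exists 0; rewrite eq_sym eqn0Ngt n0 mulr0 scale0r.
by case: eqP => [->|_]; rewrite ?mulr1 // mulr0.
Qed.

Lemma sqz_series_graded_subalgebra (Gam : nat -> A -> Prop) :
    (forall c : k, Gam 0%N c%:A) ->
    (forall n s, (0 < n)%N -> V n s -> Gam n s) ->
  graded_subalgebra Gam sqz_series.
Proof.
move=> Gam0 VGam; split.
- by move=> P [[c Pc] PV] [|n]; [rewrite Pc | apply: VGam => //; apply: PV].
- split=> [|[//|n] _]; last by rewrite coef1.
  by exists 1; rewrite coef1 scale1r.
- move=> P Q [[c Pc] PV] [[d Qd] QV]; split=> [|n n0].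
    by exists (c + d); rewrite coefD Pc Qd scalerDl.
  by rewrite coefD; apply: VD; [apply: PV | apply: QV].
- move=> P Q [[c Pc] PV] [[d Qd] QV]; split=> [|n n0].
    by exists (c * d); rewrite coefM big_ord1 Pc Qd -scalerAl mul1r scalerA.
  (* In the convolution only the two end terms, with a scalar factor, can survive; the inner ones
     vanish by [VM]. *)
  rewrite coefM; elim/big_ind: _ => [//|s t|[i /= le_in] _]; first exact: VD.
  case: i le_in => [_|i]; first by rewrite subn0 Pc -scalerAl mul1r; apply/VZ/QV.
  rewrite ltnS leq_eqVlt => /predU1P[->|lt_in].
    by rewrite subnn Qd -scalerAr mulr1; apply/VZ/PV.
  by rewrite (VM (PV i.+1 isT) (QV (n - i.+1)%N _)) ?subn_gt0.
- move=> c P [[d Pd] PV]; split=> [|n n0].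
    by exists (c * d); rewrite coefZ Pd -scalerAl mul1r scalerA.
  by rewrite coefZ -scalerAl mul1r; apply/VZ/PV.
- move=> P n [[c Pc] PV]; split=> [|m m0]; rewrite coefZ coefXn.
    have [<-|_] := eqVneq 0%N n; first by exists c; rewrite mulr1.
    by exists 0; rewrite mulr0 scale0r.
  by have [<-|_] := eqVneq m n; [rewrite mulr1; apply: PV | rewrite mulr0].
Qed.

(* A homogeneous element of positive degree has square zero, hence satisfies
   the equation X^2 = 0. *)
Lemma sqz_series_kodaira : kodaira_iitaka_is sqz_series KNegInfty.
Proof.
exists 0%N => //; split=> [|[//|m] [y [Hy yind]]]; first by left.
have [Ly [n [s [n0 yE]]]] := Hy ord0.
have Vs : V n s by apply/sqz_series_piece => //; rewrite /graded_piece -yE.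
have := yind ('X_ord0 ^+ 2).
have -> : mmap (fun c : k => (c%:A : A)%:P) y ('X_ord0 ^+ 2) = y ord0 ^+ 2.
  have -> : (fun c : k => (c%:A : A)%:P) = polyC \o in_alg A by [].
  by rewrite rmorphXn /= mmapX mmap1U.
rewrite yE expr2 -scalerAl -scalerAr scalerA (VM Vs Vs) scale0r => /(_ erefl).
by move/eqP; rewrite expf_eq0 /= => /eqP/(congr1 (mcoeff U_(ord0)))/eqP;
  rewrite mcoeffX eqxx mcoeff0 oner_eq0.
Qed.

End SquareZeroSeries.

(** * Sections of O(2n) divisible by X_1 *)

Section DoubleLineForms.
Variable k : fieldType.
Local Notation P2 := {mpoly k[3]}.
Local Notation o1 := Defs.o1.
Implicit Types f g : P2.

Definition dline_form f : dline_germs k :=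
  (germs_of (dline_pi f) : germs (dline_grading k)).

Lemma dline_form_is_zmod_morphism : zmod_morphism dline_form.
Proof. by move=> f g; rewrite /dline_form !rmorphB. Qed.
Lemma dline_form_is_monoid_morphism : monoid_morphism dline_form.
Proof. by split=> [|f g]; rewrite /dline_form ?rmorph1 ?rmorphM. Qed.

HB.instance Definition _ :=
  GRing.isZmodMorphism.Build P2 (dline_germs k) dline_form
    dline_form_is_zmod_morphism.
HB.instance Definition _ :=
  GRing.isMonoidMorphism.Build P2 (dline_germs k) dline_form
    dline_form_is_monoid_morphism.

Lemma dline_formZ c f : dline_form (c *: f) = c *: dline_form f.
Proof. by rewrite -mul_mpolyC rmorphM. Qed.

Lemma dline_form_eq0 f : dline_pi f = 0 -> dline_form f = 0.
Proof. by move=> f0; rewrite /dline_form f0 rmorph0. Qed.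

Lemma dline_form_section d f : f \is d.-homog ->
  twist_section d (dline_form f).
Proof.
move=> Hf x; exists (fun=> True); split=> //; first exact: zopenT.
exists 0%N, (dline_pi f), 1; split; [exact: gr1 | by exists f |].
by move=> y _; exists (hcompl1 y).
Qed.

(* Checked on the stalk at the generic point, where X_1 does not divide the
   denominators. *)
Lemma dline_form_X1_eq0 g :
  dline_form ('X_o1 * g) = 0 -> exists u, g = u * 'X_o1.
Proof.
move/(congr1 (fun s : germs (dline_grading k) => s (dline_generic k))).
move=> /frac_eqP[h [_ nh]]; have [f hf] := dline_pi_surj h; move: nh.
rewrite {h}hf mulr1 mul0r mulr0 => nf.
rewrite -rmorphM => /dline_pi_eq0/dline_idealP[u Hu].
(* One factor ['X_o1] cancels in the polynomial ring; the denominator [f] is not divisible by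
   ['X_o1], so [g] is. *)
apply/kill1_eq0; have : f * g = u * 'X_o1.
  apply: (mulIf (x := 'X_o1)); last by rewrite -(mulrA u) -(expr2 'X_o1) -Hu; ring.
  apply/eqP => /(congr1 (mcoeff U_(o1)))/eqP.
  by rewrite mcoeffX eqxx mcoeff0 oner_eq0.
move=> /(congr1 (kill (pred1 o1)))/eqP; rewrite !rmorphM /= kill_U /= mulr0.
rewrite mulf_eq0 => /orP[/eqP f0|/eqP //]; case: nf; exact/kill_pidealE.
Qed.

(** For n > 0 these have degree 2n - 1, one less than 2n to make room for the factor ['X_o1]. There
    are 2n monomials of that degree in the two variables, and n + 1 of them are kept. *)
Definition basis_form n (i : 'I_n.+1) : P2 :=
  'X_ord0 ^+ i * 'X_ord_max ^+ (n.*2.-1 - i).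

Definition basis_germ n (i : 'I_n.+1) : dline_germs k :=
  dline_form ('X_o1 * basis_form i).

Lemma sum_basis_germ n (c : 'I_n.+1 -> k) :
  \sum_i c i *: basis_germ i = dline_form ('X_o1 * \sum_i c i *: basis_form i).
Proof.
rewrite mulr_sumr rmorph_sum; apply: eq_bigr => i _.
by rewrite -dline_formZ scalerAr.
Qed.

Lemma sum_basis_germ_section n (c : 'I_n.+1 -> k) : (0 < n)%N ->
  twist_section (2 * n) (\sum_i c i *: basis_germ i).
Proof.
move=> n0; rewrite sum_basis_germ; apply: dline_form_section.
have -> : (2 * n = 1 + n.*2.-1)%N by rewrite mul2n add1n prednK // double_gt0.
apply: dhomogM; first exact: dhomog_Xn _ o1 1.
apply: rpred_sum => i _; apply: rpredZ.
(* The subtraction is not truncated: i <= n <= 2n - 1, as n > 0. *)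
have -> : n.*2.-1 = (i + (n.*2.-1 - i))%N.
  rewrite subnKC //; apply: leq_trans (ltnSE (ltn_ord i)) _.
  by rewrite -ltnS prednK ?double_gt0 // -addnn -[ltnLHS]addn0 ltn_add2l.
by apply: dhomogM; apply: dhomog_Xn.
Qed.

Lemma basis_germM m n (i : 'I_m.+1) (j : 'I_n.+1) :
  basis_germ i * basis_germ j = 0.
Proof.
rewrite /basis_germ !rmorphM mulrACA.
have -> : dline_form 'X_o1 * dline_form 'X_o1 = 0.
  rewrite -(rmorphM dline_form); apply: dline_form_eq0.
  by rewrite rmorphM dline_pi_X1_sqr.
by rewrite mul0r.
Qed.

(** If the combination vanishes, the same combination of the [basis_form] is a multiple of ['X_o1].
    In the chart x_2 = 1 it becomes the polynomial with coefficients [c], while ['X_o1] becomes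
    0. *)
Lemma basis_germ_free n (c : 'I_n.+1 -> k) :
  \sum_i c i *: basis_germ i = 0 -> forall i, c i = 0.
Proof.
rewrite sum_basis_germ => /dline_form_X1_eq0 [u Hu] i.
move/(congr1 (dehom ord_max)): Hu.
have X0 : dehom ord_max 'X_ord0 = 'X :> {poly k}.
  by rewrite /dehom mmapX mmap1U.
have X1 : dehom ord_max 'X_o1 = 0 :> {poly k}.
  by rewrite /dehom mmapX mmap1U.
rewrite rmorphM /= X1 mulr0 rmorph_sum /= => /(congr1 (fun p : {poly k} => p`_i)).
rewrite coef0 coef_sum (bigD1 i) //= big1 => [|j ji].
  rewrite addr0 /dehom mmapZ -/(dehom _) rmorphM !rmorphXn /= X0 dehom_Xi //.
  by rewrite expr1n mulr1 coefCM coefXn eqxx mulr1.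
rewrite /dehom mmapZ -/(dehom _) rmorphM !rmorphXn /= X0 dehom_Xi //.
rewrite expr1n mulr1 coefCM coefXn.
by rewrite eq_sym (negPf (_ : j != i :> nat)) ?mulr0.
Qed.

End DoubleLineForms.

(** * The series attached to a set of degrees *)

Theorem mainTheorem7 (k : fieldType) (T : nat -> Prop)
    (hT : forall n, T n -> (0 < n)%N) :
  exists L : {poly dline_germs k} -> Prop,
    [/\ dline_series 2 L,
        forall n, (0 < n)%N ->
          (T n -> dim_is (graded_piece L n) n.+1) /\
          (~ T n -> dim_is (graded_piece L n) 0),
        kodaira_iitaka_is L KNegInfty,
        proj_dim_is (dline_grading k) 1 &
        exists C : nat, forall n, (0 < n)%N ->
          exists2 r, dim_is (graded_piece L n) r & (r <= C * n ^ 1)%N].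
Proof.
(* The span of the [basis_germ] for n in [T], and the zero space otherwise. *)
pose V n (s : dline_germs k) :=
  s = 0 \/ T n /\ exists c : 'I_n.+1 -> k, s = \sum_i c i *: basis_germ i.
have V0 n : V n 0 by left.
have VD n s t : V n s -> V n t -> V n (s + t).
  move=> [->|Vs] [->|Vt]; rewrite ?add0r ?addr0; [by left | by right | by right |].
  move: Vs Vt => [Tn [c ->]] [_ [d ->]]; right; split=> //.
  exists (fun i => c i + d i).
  by rewrite -big_split; apply: eq_bigr => i _; rewrite scalerDl.
have VZ n (c : k) s : V n s -> V n (c *: s).
  move=> [->|[Tn [d ->]]]; first by left; rewrite scaler0.
  right; split=> //; exists (fun i => c * d i).
  by rewrite scaler_sumr; apply: eq_bigr => i _; rewrite scalerA.
have VM m n s t : V m s -> V n t -> s * t = 0.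
  move=> [->|[_ [c ->]]]; first by rewrite mul0r.
  move=> [->|[_ [d ->]]]; first by rewrite mulr0.
  rewrite mulr_suml big1 // => i _; rewrite mulr_sumr big1 // => j _.
  by rewrite -scalerAl -scalerAr basis_germM !scaler0.
have dimT n : (0 < n)%N -> T n -> dim_is (graded_piece (sqz_series V) n) n.+1.
  move=> n0 Tn; exists (@basis_germ k n); split=> [i|c|s].
  - apply/sqz_series_piece => //; right; split=> //.
    exists (fun j => (j == i)%:R); rewrite (bigD1 i) //= eqxx scale1r big1 ?addr0 //.
    by move=> j /negPf ->; rewrite scale0r.
  - exact: basis_germ_free.
  - move/sqz_series_piece => /(_ V0 n0) [->|[_ //]].
    by exists (fun=> 0); rewrite big1 // => i _; rewrite scale0r.
have dimnT n : (0 < n)%N -> ~ T n -> dim_is (graded_piece (sqz_series V) n) 0.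
  move=> n0 nTn; exists (fun=> 0); split=> [[]//|c _ []//|s].
  move/sqz_series_piece => /(_ V0 n0) [->|[//]].
  by exists (fun=> 0); rewrite big_ord0.
exists (sqz_series V); split.
- apply: sqz_series_graded_subalgebra => // [c|n s n0].
    (* Scalars are the sections given by forms of degree 0. *)
    rewrite muln0 -(rmorph1 (@dline_form k)) -dline_formZ.
    by apply: dline_form_section; rewrite rpredZ // dhomog1.
  move=> [->|[_ [c ->]]]; last exact: sum_basis_germ_section.
  by rewrite -(rmorph0 (@dline_form k)); apply/dline_form_section/dhomog0.
- by move=> n n0; split; [apply: dimT | apply: dimnT].
- exact: sqz_series_kodaira.
- exact: proj_dim_dline.
(* The constant 2 works because n + 1 <= 2n for n > 0. *)
- exists 2%N => n n0; rewrite expn1.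
  have [Tn|nTn] := pselect (T n); last by exists 0%N; first exact: dimnT.
  exists n.+1; first exact: dimT.
  by rewrite mul2n -addnn -add1n leq_add2r.
Qed.
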